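(* Let $\mathcal{M}$ be a deep GRU model with weights $\Phi_m^*$, $\xi_m^+ = f_m(\xi_m, u; \Phi_m^* )$, $y_m = g_m(\xi_m; \Phi_m^* )$, with input $u \in \mathbb{R}^m$, output $y_m \in \mathbb{R}^p$ and linear (affine) output map. Let $\mathcal{C}$ be a deep GRU controller with weights $\Phi_c$, $\xi_c^+ = f_c(\xi_c, w; \Phi_c)$, $u_c = g_c(\xi_c; \Phi_c)$, with input $w \in \mathbb{R}^p$, output $u_c \in \mathbb{R}^m$ and $\tanh$ output activation. Let $\mathcal{P}$ be an input-output stable plant with input $u \in \mathbb{R}^m$ and output $y_p\in\mathbb{R}^p$. Assume that $\mathcal{P}$ can be described by the equations of the model with a fictitious additive output disturbance $d$ accounting for the plant-model mismatch, i.e. $$\mathcal{P}: \quad x^+ = f_m(x, u; \Phi_m^* ), \qquad y_p = g_m(x; \Phi_m^* ) + d .$$ If $\mathcal{M}$ and $\mathcal{C}$ are both $\delta$ISS, then the closed-loop Internal Model Control scheme formed by $\mathcal{P}$, $\mathcal{M}$ and $\mathcal{C}$ is input-output stable with respect to the reference trajectory $\tilde{\bm{y}}^0$: for all initial states $\bar{x}$, $\bar{\xi}_m$, $\bar{\xi}_c$ of $\mathcal{P}$, $\mathcal{M}$, $\mathcal{C}$ and every bounded reference sequence $\tilde{\bm{y}}^0 = \{\tilde{y}^0(k)\}_{k \ge 0}$ in $\mathbb{R}^p$, the resulting closed-loop output sequence $\{y_p(k)\}_{k\geq 0}$ is bounded.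
   Context: All systems are in discrete time $k = 0,1,2,\dots$; $x^+$ denotes $x(k+1)$ when $x = x(k)$. $\circ$ is the element-wise product; $\sigma(s) = 1/(1+e^{-s})$ and $\phi(s) = \tanh(s)$ are applied component-wise. **Deep GRU.** A deep GRU with $M$ layers, input $v$, output $\zeta$ and weights $\Phi = \{\{W_z^l, U_z^l, b_z^l, W_r^l, U_r^l, b_r^l, W_f^l, U_f^l, b_f^l\}_{l=1,\dots,M}, U_o, b_o\}$ (real matrices and vectors of compatible dimensions) has state $\xi = (\xi^1, \dots, \xi^M) \in \mathbb{R}^n$, $\xi^l \in \mathbb{R}^{n_l}$, $n=\sum_l n_l$. For each layer $l$, $$\xi^{l,+} = z^l \circ \xi^l + (1 - z^l) \circ \phi\big(W_r^l v^l + U_r^l (f^l \circ \xi^l) + b_r^l\big),$$ $$z^l = \sigma(W_z^l v^l + U_z^l \xi^l + b_z^l), \qquad f^l = \sigma(W_f^l v^l + U_f^l \xi^l + b_f^l),$$ where $v^1 = v$ and $v^l = \xi^{l-1,+}$ for $l = 2, \dots, M$. The output is $\zeta = \psi(U_o \xi^M + b_o)$. These equations are written compactly as $\xi^+ = f(\xi, v; \Phi)$, $\zeta = g(\xi; \Phi)$. For the model $\mathcal{M}$, $\psi$ is the identity, i.e. $g_m(\xi_m;\Phi_m^* ) = U_{o,m}\xi_m^M + b_{o,m}$. For the controller $\mathcal{C}$, $\psi = \phi = \tanh$, i.e. $g_c(\xi_c;\Phi_c) = \phi(U_{o,c}\xi_c^M + b_{o,c})$. (The two networks may have different numbers of layers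 and units.) **$\delta$ISS.** A function $\Psi(s)$, $s \ge 0$, is of class $\mathcal{K}_\infty$ if it is (continuous and) strictly increasing, $\Psi(0)=0$, and $\Psi(s)\to\infty$ as $s\to\infty$; $\Psi(s,t)$ is of class $\mathcal{KL}$ if it is $\mathcal{K}_\infty$ in $s$ and $\Psi(s,t)\to 0$ as $t\to\infty$. Let $\mathcal{V}$ be the set of input sequences taking values in the unit box $[-1,1]^q$, $q$ being the input dimension. For a sequence $\bm{v}_k = \{v(0),\dots,v(k)\}$, $\|\bm{v}_k\|_{2,\infty} = \max_{0\le t\le k}\|v(t)\|_2$. A system $\xi^+ = f(\xi, v)$ is Incrementally Input-to-State Stable ($\delta$ISS) if there exist $\beta \in \mathcal{KL}$ and $\gamma_v \in \mathcal{K}_\infty$ such that for any initial states $\bar{\xi}_a, \bar{\xi}_b$, any input sequences $\bm{v}_{a}, \bm{v}_{b} \in \mathcal{V}$ and any time $k$, $$\|\xi(k,\bar{\xi}_a,\bm{v}_{a}) - \xi(k,\bar{\xi}_b,\bm{v}_{b})\|_2 \le \beta(\|\bar{\xi}_a - \bar{\xi}_b\|_2, k) + \gamma_v(\|\bm{v}_{a,k} - \bm{v}_{b,k}\|_{2,\infty}),$$ where $\xi(k,\bar{\xi},\bm{v})$ is the state at time $k$ when the system starts from $\bar{\xi}$ and is fed with $\bm{v}$. **Input-output stability.** A system with input $u$ and output $y$ is input-output stable if, from any initial state, every bounded input sequence produces a bounded output sequence. **Plant and disturbance.** The disturbance $d = \{d(k)\}_{k\ge0}$ in $\mathbb{R}^p$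 is a fictitious signal (not assumed bounded a priori) defined as the discrepancy between the plant output and $g_m(x(k);\Phi_m^* )$; $d(k)$ may depend on the plant's initial state and on the inputs applied before time $k$. The plant $\mathcal{P}$, as a map from $u$ to $y_p$ (with $d$ included), is input-output stable. **Closed-loop IMC scheme.** Given the reference sequence $\tilde{y}^0(k) \in \mathbb{R}^p$ (in the full scheme obtained by filtering a set-point through a reference model, which plays no role here), at each time $k$: the control action $u(k) = u_c(k) = g_c(\xi_c(k);\Phi_c)$ is applied to both $\mathcal{P}$ and $\mathcal{M}$; the modeling error feedback is $e_m(k) = y_p(k) - y_m(k)$; and the controller input is $w(k) = \tilde{y}^0(k) - e_m(k)$. *)

(* Defs.v *)
From HB Require Import structures.
From mathcomp Require Import all_boot all_order all_algebra.
From mathcomp Require Import all_classical all_reals all_analysis.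

Set Implicit Arguments.
Unset Strict Implicit.
Unset Printing Implicit Defensive.

Import Order.TTheory GRing.Theory Num.Theory.
Import numFieldNormedType.Exports.

Local Open Scope classical_set_scope.
Local Open Scope ring_scope.

Definition sigmoid {R : realType} (s : R) : R := (1 + expR (- s))^-1.

Definition tanh {R : realType} (s : R) : R :=
  (expR s - expR (- s)) / (expR s + expR (- s)).

(* The norm that the library puts on matrices is the max norm; this is the
   Euclidean one. *)
Definition norm2 {R : realType} {n : nat} (v : 'cV[R]_n) : R :=
  Num.sqrt (\sum_i v i 0 ^+ 2).

Definition hadamard {R : realType} {n : nat} (a b : 'cV[R]_n) : 'cV[R]_n :=
  map2_mx *%R a b.

(** * Deep GRU networks *)

Record gru_layer (R : realType) (q n : nat) := GruLayer {
  Wz : 'M[R]_(n, q); Uz : 'M[R]_n; bz : 'cV[R]_n;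
  Wr : 'M[R]_(n, q); Ur : 'M[R]_n; br : 'cV[R]_n;
  Wf : 'M[R]_(n, q); Uf : 'M[R]_n; bf : 'cV[R]_n }.

Definition layer_step {R : realType} {q n : nat} (L : gru_layer R q n)
    (xi : 'cV[R]_n) (v : 'cV[R]_q) : 'cV[R]_n :=
  let z := map_mx sigmoid (Wz L *m v + Uz L *m xi + bz L) in
  let f := map_mx sigmoid (Wf L *m v + Uf L *m xi + bf L) in
  hadamard z xi +
  hadamard (const_mx 1 - z)
    (map_mx tanh (Wr L *m v + Ur L *m hadamard f xi + br L)).

(* [gru_layers R q ns] are the weights of a stack of layers fed with an input
   of dimension [q], whose numbers of units are listed in [ns], first layer
   first: the input dimension of a layer is the width of the previous one. *)
Fixpoint gru_layers (R : realType) (q : nat) (ns : seq nat) : Type :=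
  if ns is n :: ns' then (gru_layer R q n * gru_layers R n ns')%type else unit.

(* The state (xi^1, ..., xi^M) is a single vector of dimension [sumn ns], as
   [sumn (n :: ns')] is convertible to [n + sumn ns'].  Each layer is fed with
   the updated state of the previous one. *)
Fixpoint layers_step {R : realType} {q : nat} {ns : seq nat} :
    gru_layers R q ns -> 'cV[R]_(sumn ns) -> 'cV[R]_q -> 'cV[R]_(sumn ns) :=
  match ns return
    gru_layers R q ns -> 'cV[R]_(sumn ns) -> 'cV[R]_q -> 'cV[R]_(sumn ns)
  with
  | [::] => fun _ xi _ => xi
  | n :: ns' => fun Phi (xi : 'cV[R]_(n + sumn ns')) v =>
      let xi1 := layer_step Phi.1 (usubmx xi) v in
      col_mx xi1 (layers_step Phi.2 (dsubmx xi) xi1)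
  end.

Fixpoint last_state {R : realType} {n : nat} {ns : seq nat} :
    'cV[R]_(n + sumn ns) -> 'cV[R]_(last n ns) :=
  match ns return 'cV[R]_(n + sumn ns) -> 'cV[R]_(last n ns) with
  | [::] => fun xi => usubmx xi
  | n' :: ns' => fun xi => @last_state R n' ns' (dsubmx xi)
  end.

(* The layer widths are [n :: ns], so that there is at least one layer. *)
Record deep_gru (R : realType) (q n : nat) (ns : seq nat) (p : nat) := DeepGru {
  layers : gru_layers R q (n :: ns);
  Uo : 'M[R]_(p, last n ns);
  bo : 'cV[R]_p }.

Definition gru_step {R : realType} {q n : nat} {ns : seq nat} {p : nat}
    (Phi : deep_gru R q n ns p) :
    'cV[R]_(sumn (n :: ns)) -> 'cV[R]_q -> 'cV[R]_(sumn (n :: ns)) :=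
  layers_step (layers Phi).

Definition gru_output {R : realType} {q n : nat} {ns : seq nat} {p : nat}
    (psi : R -> R) (Phi : deep_gru R q n ns p)
    (xi : 'cV[R]_(sumn (n :: ns))) : 'cV[R]_p :=
  map_mx psi (Uo Phi *m last_state xi + bo Phi).

(** * Discrete-time systems *)

Fixpoint state_at {X V : Type} (f : X -> V -> X) (x0 : X) (v : nat -> V)
    (k : nat) : X :=
  if k is k'.+1 then f (state_at f x0 v k') (v k') else x0.

Definition response {X V Y : Type} (f : X -> V -> X) (g : X -> Y)
    (x0 : X) (v : nat -> V) (k : nat) : Y :=
  g (state_at f x0 v k).

Definition bounded_sequence {R : realType} {n : nat} (v : nat -> 'cV[R]_n) :
    Prop :=
  exists B : R, forall k, norm2 (v k) <= B.

(* An input/output system is given by its map from an initial state and an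
   input sequence to an output sequence. *)
Definition io_stable {R : realType} {X : Type} {m p : nat}
    (P : X -> (nat -> 'cV[R]_m) -> nat -> 'cV[R]_p) : Prop :=
  forall (x0 : X) (u : nat -> 'cV[R]_m),
    bounded_sequence u -> bounded_sequence (P x0 u).

(** * Incremental input-to-state stability *)

(* Comparison functions live on the nonnegative reals; they are total functions
   on [R] here, whose values at negative arguments are irrelevant. *)
Definition class_Kinfty {R : realType} (Psi : R -> R) : Prop :=
  [/\ {within `[0, +oo[, continuous Psi},
      {in >= 0 &, {homo Psi : s t / s < t}},
      Psi 0 = 0
    & Psi s @[s --> +oo] --> +oo].

Definition class_KL {R : realType} (Psi : R -> R -> R) : Prop :=
  (forall t, 0 <= t -> class_Kinfty (fun s => Psi s t)) /\
  (forall s, 0 <= s -> Psi s t @[t --> +oo] --> 0).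

Definition in_unit_box {R : realType} {q : nat} (v : nat -> 'cV[R]_q) : Prop :=
  forall t i, `|v t i 0| <= 1.

Definition norm2_infty {R : realType} {q : nat} (v : nat -> 'cV[R]_q)
    (k : nat) : R :=
  \big[Num.max/0]_(t < k.+1) norm2 (v t).

Definition deltaISS {R : realType} {n q : nat}
    (f : 'cV[R]_n -> 'cV[R]_q -> 'cV[R]_n) : Prop :=
  exists (beta : R -> R -> R) (gamma : R -> R),
    [/\ class_KL beta, class_Kinfty gamma
      & forall (xa xb : 'cV[R]_n) (va vb : nat -> 'cV[R]_q) (k : nat),
          in_unit_box va -> in_unit_box vb ->
          norm2 (state_at f xa va k - state_at f xb vb k) <=
            beta (norm2 (xa - xb)) k%:R
            + gamma (norm2_infty (fun t => va t - vb t) k)].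

(** * Internal Model Control *)

(* [d x0 us] is the disturbance at time [size us], when the plant started from
   [x0] and was fed with the inputs [us] (oldest first): it cannot depend on the
   current or future inputs. *)
Definition described_by {R : realType} {n m p : nat}
    (P : 'cV[R]_n -> (nat -> 'cV[R]_m) -> nat -> 'cV[R]_p)
    (f : 'cV[R]_n -> 'cV[R]_m -> 'cV[R]_n) (g : 'cV[R]_n -> 'cV[R]_p)
    (d : 'cV[R]_n -> seq 'cV[R]_m -> 'cV[R]_p) : Prop :=
  forall x0 u k, P x0 u k = response f g x0 u k + d x0 (mkseq u k).

(* [P], [M] and [C] are the maps from input to output sequences of the plant,
   the model and the controller, for fixed initial states. *)
Record imc_loop {R : realType} {m p : nat}
    (P M : (nat -> 'cV[R]_m) -> nat -> 'cV[R]_p)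
    (C : (nat -> 'cV[R]_p) -> nat -> 'cV[R]_m)
    (yref : nat -> 'cV[R]_p) (u : nat -> 'cV[R]_m)
    (yp ym em w : nat -> 'cV[R]_p) : Prop := ImcLoop {
  imc_u : forall k, u k = C w k;
  imc_yp : forall k, yp k = P u k;
  imc_ym : forall k, ym k = M u k;
  imc_em : forall k, em k = yp k - ym k;
  imc_w : forall k, w k = yref k - em k }.

Lemma state_at_foldl {X V : Type} (f : X -> V -> X) x0 v k :
  state_at f x0 v k = foldl f x0 (mkseq v k).
Proof.
elim: k => [//|k IH].
by rewrite mkseqS foldl_rcons -IH.
Qed.

(* The loop is well posed: controller outputs and disturbances depend on past
   inputs only, so the equations have exactly one solution. *)
Lemma imc_loop_exists {R : realType} {n nc m p : nat}
    (P : 'cV[R]_n -> (nat -> 'cV[R]_m) -> nat -> 'cV[R]_p)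
    (fm : 'cV[R]_n -> 'cV[R]_m -> 'cV[R]_n) (gm : 'cV[R]_n -> 'cV[R]_p)
    (d : 'cV[R]_n -> seq 'cV[R]_m -> 'cV[R]_p)
    (fc : 'cV[R]_nc -> 'cV[R]_p -> 'cV[R]_nc) (gc : 'cV[R]_nc -> 'cV[R]_m)
    x0 xm0 xc0 yref :
  described_by P fm gm d ->
  exists u yp ym em w,
    imc_loop (P x0) (response fm gm xm0) (response fc gc xc0)
      yref u yp ym em w.
Proof.
move=> hP.
pose e us := gm (foldl fm x0 us) + d x0 us - gm (foldl fm xm0 us).
pose step k (s : 'cV[R]_nc * seq 'cV[R]_m) :=
  (fc s.1 (yref k - e s.2), rcons s.2 (gc s.1)).
pose S k := iteri k step (xc0, [::]).
pose u k := gc (S k).1.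
have Su k : (S k).2 = mkseq u k.
  elim: k => [//|k IH]; rewrite -[LHS]/(rcons (S k).2 (gc (S k).1)) IH.
  by rewrite mkseqS.
pose yp := P x0 u; pose ym := response fm gm xm0 u.
pose em k := yp k - ym k; pose w k := yref k - em k.
have eE k : em k = e (S k).2.
  by rewrite /em /yp /ym hP /response !state_at_foldl Su.
have Sc k : (S k).1 = state_at fc xc0 w k.
  by elim: k => [//|k IH]; rewrite [RHS]/= -IH /w eE.
by exists u, yp, ym, em, w; split=> // k; rewrite /response -Sc.
Qed.

Lemma imc_loop_unique {R : realType} {n nc m p : nat}
    (P : 'cV[R]_n -> (nat -> 'cV[R]_m) -> nat -> 'cV[R]_p)
    (fm : 'cV[R]_n -> 'cV[R]_m -> 'cV[R]_n) (gm : 'cV[R]_n -> 'cV[R]_p)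
    (d : 'cV[R]_n -> seq 'cV[R]_m -> 'cV[R]_p)
    (fc : 'cV[R]_nc -> 'cV[R]_p -> 'cV[R]_nc) (gc : 'cV[R]_nc -> 'cV[R]_m)
    x0 xm0 xc0 yref u yp ym em w u' yp' ym' em' w' :
  described_by P fm gm d ->
  imc_loop (P x0) (response fm gm xm0) (response fc gc xc0)
    yref u yp ym em w ->
  imc_loop (P x0) (response fm gm xm0) (response fc gc xc0)
    yref u' yp' ym' em' w' ->
  forall k, u k = u' k /\ yp k = yp' k.
Proof.
move=> hP [Hu Hyp Hym Hem Hw] [Hu' Hyp' Hym' Hem' Hw'].
pose uw k := mkseq u k = mkseq u' k /\ mkseq w k = mkseq w' k.
have outE k : uw k -> [/\ u k = u' k, yp k = yp' k & w k = w' k].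
  move=> [Eu Ew].
  have ypE : yp k = yp' k.
    by rewrite Hyp Hyp' !hP /response !state_at_foldl Eu.
  split=> //; first by rewrite Hu Hu' /response !state_at_foldl Ew.
  by rewrite Hw Hw' Hem Hem' ypE Hym Hym' /response !state_at_foldl Eu.
suff uwE k : uw k by move=> k; have [] := outE k (uwE k).
elim: k => [//|k IH]; have [Eu _ Ew] := outE k IH; case: IH => IHu IHw.
by split; rewrite !mkseqS ?IHu ?IHw ?Eu ?Ew.
Qed.

(* Main.v *)
(* The tanh output activation keeps the control action in the unit box whatever
   the controller input is, so the input-output stability of the plant bounds
   its output. *)

Require Import Defs.
From mathcomp Require Import all_boot all_order all_algebra.
From mathcomp Require Import all_classical all_reals all_analysis.

Import Order.TTheory GRing.Theory Num.Theory.

Local Open Scope ring_scope.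

(** Entries of [u] are values of [tanh], so [normr_tanh_le1] and [unit_box_bounded] bound [u] in
    Euclidean norm; [io_stable P] at this [u] then bounds [P x0 u], which is [yp]. *)

(** Triangle inequality on the numerator: both exponentials are positive, so their sum is the
    denominator. *)
Lemma normr_tanh_le1 (R : realType) (s : R) : `|tanh s| <= 1.
Proof.
have ep := expR_gt0 s; have en := expR_gt0 (- s).
have D0 : 0 < expR s + expR (- s) by rewrite addr_gt0.
rewrite /tanh normrM normfV (gtr0_norm D0) ler_pdivrMr // mul1r.
by rewrite (le_trans (ler_normB _ _)) // !gtr0_norm.
Qed.

Lemma unit_box_bounded (R : realType) (n : nat) (v : nat -> 'cV[R]_n) :
  in_unit_box v -> bounded_sequence v.
Proof.
(* The Euclidean norm of a corner of the box. *)
move=> hv; exists (Num.sqrt n%:R) => k.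
(* Rewriting [n] as a sum of ones over ['I_n] allows a termwise comparison. *)
rewrite /norm2 ler_wsqrtr // -[X in X%:R](card_ord n) -sumr_const.
by apply: ler_sum => i _; rewrite -real_normK ?num_real // expr_le1.
Qed.

Theorem proposition1 (R : realType) (m p : nat)
    (nm : nat) (nsm : seq nat) (Phim : deep_gru R m nm nsm p)
    (nc : nat) (nsc : seq nat) (Phic : deep_gru R p nc nsc m)
    (P : 'cV[R]_(sumn (nm :: nsm)) ->
         (nat -> 'cV[R]_m) -> nat -> 'cV[R]_p)
    (d : 'cV[R]_(sumn (nm :: nsm)) -> seq 'cV[R]_m -> 'cV[R]_p) :
  io_stable P ->
  described_by P (gru_step Phim) (gru_output id Phim) d ->
  deltaISS (gru_step Phim) ->
  deltaISS (gru_step Phic) ->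
  forall (x0 xim0 : 'cV[R]_(sumn (nm :: nsm)))
         (xic0 : 'cV[R]_(sumn (nc :: nsc)))
         (yref : nat -> 'cV[R]_p) (u : nat -> 'cV[R]_m)
         (yp ym em w : nat -> 'cV[R]_p),
    bounded_sequence yref ->
    imc_loop (P x0)
      (response (gru_step Phim) (gru_output id Phim) xim0)
      (response (gru_step Phic) (gru_output tanh Phic) xic0)
      yref u yp ym em w ->
    bounded_sequence yp.
Proof.
move=> stableP _ _ _ x0 xim0 xic0 yref u yp ym em w _ [u_eq yp_eq _ _ _].
(* [io_stable] covers every bounded input, including one generated by feedback. *)
have [|B hB] := stableP x0 u.
  apply: unit_box_bounded => k i.
  by rewrite u_eq /response /gru_output mxE normr_tanh_le1.
by exists B => k; rewrite yp_eq.
Qed.
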